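(* Let $(W,S)$ be a dihedral Coxeter system of order $4m$ with $m\ge 1$, i.e. $S=\{s,t\}$ and $st$ has order $2m$. If $A=\{s,t,sts\}$ or $A=\{t,sts\}$, then $\mathcal{D}_A(W)$ is a subalgebra of $\mathbb{Z}W$.
   Context: $\ell$ is the length function of $(W,S)$ and $T=\{wsw^{-1}\mid w\in W, s\in S\}$ is the set of reflections. For $A\subseteq T$ and $w\in W$, $D_A(w)=\{r\in A\mid \ell(wr)<\ell(w)\}$. A subset $I\subseteq A$ is $A$-admissible if $I=D_A(w)$ for some $w\in W$; $\mathcal{P}_{\mathrm{ad}}(A)$ denotes the set of these. For $I\in\mathcal{P}_{\mathrm{ad}}(A)$ let $D_I^A=\{w\in W\mid D_A(w)=I\}$, $d_I^A=\sum_{w\in D_I^A}w$, and $\mathcal{D}_A(W)=\bigoplus_{I\in\mathcal{P}_{\mathrm{ad}}(A)}\mathbb{Z}d_I^A\subseteq\mathbb{Z}W$. A subalgebra need not contain $1$. *)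

(* Defs.v *)
From HB Require Import structures.
From mathcomp Require Import all_boot all_order all_algebra all_fingroup.

Set Implicit Arguments.
Unset Strict Implicit.
Unset Printing Implicit Defensive.

Import GRing.Theory.
Local Open Scope group_scope.

(* The presentation < S | (x y)^{m(x,y)} = 1 > with m(x,y) the order of x y;
   the relators with x = y say that the images of the generators square to 1. *)
Definition coxeter_system (W : finGroupType) (S : {set W}) : Prop :=
  [/\ <<S>> = [set: W],
      forall x, x \in S -> #[x] = 2
    & forall (H : groupType) (f : W -> H),
        {in S &, forall x y, (f x * f y) ^+ #[x * y] = 1} ->
        exists g : {multiplicative W -> H}, {in S, g =1 f}].

Section Length.
Variables (W : finGroupType) (S : {set W}).

(* [S ^+ n] is the set of products of n elements of S.  The search stops below
   #|W|, which bounds all lengths: see cox_length_min. *)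
Definition cox_length (w : W) : nat :=
  find (fun n => w \in S ^+ n) (iota 0 #|W|).

Lemma gen_expgs (w : W) : w \in <<S>> -> exists2 n, n < #|W| & w \in S ^+ n.
Proof.
move=> /gen_prodgP[n [c cS ->]].
(* a shortest word for an element has pairwise distinct prefixes *)
suff H : forall k (u : seq W), size u <= k -> all (mem S) u ->
    exists2 n, n < #|W| & \prod_(x <- u) x \in S ^+ n.
  have := H _ [seq c i | i <- index_enum 'I_n] (leqnn _).
  rewrite big_map; apply.
  by apply/allP => _ /mapP[i _ ->]; apply: cS.
elim=> [|k IHk] u.
  rewrite leqn0 size_eq0 => /eqP-> _; exists 0.
    by apply/card_gt0P; exists 1.
  by rewrite big_nil expg0 inE.
move=> szu uS.
case: (ltnP (size u) #|W|) => [ltu|leu].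
  exists (size u) => //; elim: (u) uS => [|x v IHv] /=.
    by rewrite big_nil expg0 inE.
  by case/andP=> xS vS; rewrite big_cons expgS mem_mulg // IHv.
pose p (i : 'I_(size u).+1) := \prod_(x <- take i u) x.
have /injectivePn[i [j neij pij]] : ~~ injectiveb p.
  apply/negP => /injectiveP /leq_card.
  by rewrite card_ord => /leq_trans/(_ leu); rewrite ltnn.
wlog ltij : i j neij pij / i < j.
  move=> Hw; case: (ltngtP i j) => [||/val_inj eij].
  - exact: Hw.
  - by apply: Hw => //; rewrite eq_sym.
  - by rewrite eij eqxx in neij.
have -> : \prod_(x <- u) x = \prod_(x <- take i u ++ drop j u) x.
  rewrite big_cat /=; move: pij; rewrite /p => ->.
  by rewrite -big_cat cat_take_drop.
apply: IHk; last first.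
  rewrite all_cat; apply/andP; split; apply/allP => x.
    by move/mem_take; apply/allP.
  by move/mem_drop; apply/allP.
have lej : j <= size u by rewrite -ltnS.
rewrite size_cat size_drop size_take (leq_trans ltij lej).
rewrite -ltnS; apply: leq_trans szu.
by rewrite -[X in _ < X](subnKC lej) ltn_add2r.
Qed.

Lemma cox_length_min (w : W) : w \in <<S>> ->
  w \in S ^+ cox_length w /\
  forall n, w \in S ^+ n -> cox_length w <= n.
Proof.
move=> /gen_expgs[n0 ltn0 wn0].
have hasw : has (fun n => w \in S ^+ n) (iota 0 #|W|).
  by apply/hasP; exists n0; rewrite // mem_iota.
have ltl : cox_length w < #|W| by rewrite -[X in _ < X](size_iota 0) -has_find.
split; first by have := nth_find 0 hasw; rewrite nth_iota.
move=> n wn; rewrite leqNgt; apply/negP => ltn.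
have := before_find 0 ltn; rewrite nth_iota ?add0n ?wn //.
exact: ltn_trans ltl.
Qed.

Definition reflections : {set W} := [set w * x * w^-1 | w in [set: W], x in S].

Definition descents (A : {set W}) (w : W) : {set W} :=
  [set r in A | cox_length (w * r) < cox_length w].

Definition admissible (A : {set W}) : {set {set W}} :=
  [set descents A w | w : W].

Definition descent_class (A I : {set W}) : {set W} :=
  [set w | descents A w == I].

End Length.

Lemma reflections_dihedral (W : finGroupType) (s t : W) : #[s] = 2 ->
  [set s; t; s * t * s] \subset reflections [set s; t].
Proof.
move=> os; have sV : s^-1 = s.
  by apply/eqP; rewrite eq_invg_mul -[s * s]/(s ^+ 2) -os expg_order.
apply/subsetP => x; rewrite !inE => /orP[/orP[]|] /eqP->.
- by apply/imset2P; exists 1 s; rewrite ?inE ?eqxx // invg1 mul1g mulg1.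
- by apply/imset2P; exists 1 t; rewrite ?inE ?eqxx ?orbT // invg1 mul1g mulg1.
- by apply/imset2P; exists s t; rewrite ?inE ?eqxx ?orbT ?sV.
Qed.

Local Open Scope ring_scope.

(* The group ring Z[W]: functions W -> Z with the convolution product. *)
Definition ZGroupRing (W : finGroupType) : Type := {ffun W -> int}.

Section GroupRing.
Variable W : finGroupType.
Implicit Types a b c : {ffun W -> int}.

HB.instance Definition _ := GRing.Zmodule.copy (ZGroupRing W) {ffun W -> int}.

Definition gr_elt (g : W) : ZGroupRing W := [ffun w => (w == g)%:R].

Definition gr_mul a b : {ffun W -> int} :=
  [ffun w => \sum_(u : W) a u * b (u^-1 * w)%g].

Fact gr_mulA : associative gr_mul.
Proof.
move=> a b c; apply/ffunP => w; rewrite !ffunE.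
under eq_bigr => u _ do rewrite ffunE mulr_sumr.
under [RHS]eq_bigr => u _ do rewrite ffunE mulr_suml.
rewrite [RHS]exchange_big /=; apply: eq_bigr => u _.
rewrite [RHS](reindex_inj (mulgI u)) /=; apply: eq_bigr => v _.
by rewrite mulKg invMg mulgA mulrA.
Qed.

Fact gr_mul1l : left_id (gr_elt 1%g : {ffun W -> int}) gr_mul.
Proof.
move=> a; apply/ffunP => w; rewrite ffunE (bigD1 1%g) //= ffunE eqxx mul1r.
rewrite invg1 mul1g big1 ?addr0 // => u /negPf nu.
by rewrite ffunE nu mul0r.
Qed.

Fact gr_mul1r : right_id (gr_elt 1%g : {ffun W -> int}) gr_mul.
Proof.
move=> a; apply/ffunP => w; rewrite ffunE (bigD1 w) //= ffunE mulVg eqxx mulr1.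
rewrite big1 ?addr0 // => u nu.
by rewrite ffunE -eq_mulVg1 (negPf nu) mulr0.
Qed.

Fact gr_mulDl : left_distributive gr_mul +%R.
Proof.
move=> a b c; apply/ffunP => w; rewrite !ffunE -big_split.
by apply: eq_bigr => u _; rewrite ffunE mulrDl.
Qed.

Fact gr_mulDr : right_distributive gr_mul +%R.
Proof.
move=> a b c; apply/ffunP => w; rewrite !ffunE -big_split.
by apply: eq_bigr => u _; rewrite ffunE mulrDr.
Qed.

Fact gr_1neq0 : (gr_elt 1%g : {ffun W -> int}) != 0.
Proof. by apply/eqP => /ffunP/(_ 1%g); rewrite !ffunE eqxx. Qed.

HB.instance Definition _ := GRing.Zmodule_isNzRing.Build (ZGroupRing W)
  gr_mulA gr_mul1l gr_mul1r gr_mulDl gr_mulDr gr_1neq0.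

Lemma gr_eltM (g h : W) : gr_elt g * gr_elt h = gr_elt (g * h)%g.
Proof.
apply/ffunP => w; rewrite ffunE (bigD1 g) //= !ffunE eqxx mul1r.
rewrite big1 ?addr0 => [|u /negPf nu]; last by rewrite ffunE nu mul0r.
by rewrite -(inj_eq (mulgI g)) mulKVg.
Qed.

End GroupRing.

(* A Z-submodule closed under products; it need not contain 1. *)
Definition subalgebra (R : nzRingType) (P : R -> Prop) : Prop :=
  [/\ P 0,
      forall x y, P x -> P y -> P (x + y),
      forall (k : int) x, P x -> P (x *~ k)
    & forall x y, P x -> P y -> P (x * y)].

Definition descent_sum (W : finGroupType) (S A I : {set W}) : ZGroupRing W :=
  \sum_(w in descent_class S A I) gr_elt w.

(* The sum is direct: see descent_sum_free. *)
Definition descent_module (W : finGroupType) (S A : {set W})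
    (x : ZGroupRing W) : Prop :=
  exists c : {set W} -> int,
    x = \sum_(I in admissible S A) descent_sum S A I *~ c I.

Lemma descent_sumE (W : finGroupType) (S A I : {set W}) (w : W) :
  descent_sum S A I w = (descents S A w == I)%:R.
Proof.
rewrite /descent_sum sum_ffunE.
have [wI|wI] := boolP (descents S A w == I).
  rewrite (bigD1 w) ?inE //= ffunE eqxx big1 ?addr0 // => u /andP[_ nu].
  by rewrite ffunE eq_sym (negPf nu).
rewrite big1 // => u; rewrite inE => uI; rewrite ffunE.
by case: (w =P u) => // ewu; rewrite ewu uI in wI.
Qed.

Lemma descent_sum_free (W : finGroupType) (S A : {set W})
    (c : {set W} -> int) :
  \sum_(I in admissible S A) descent_sum S A I *~ c I = 0 ->
  {in admissible S A, forall I, c I = 0}.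
Proof.
move=> /ffunP sum0 I /[dup] adI /imsetP[w _ defI].
have := sum0 w; rewrite sum_ffunE [RHS]ffunE => <-.
have mulzE (a : ZGroupRing W) (k : int) : (a *~ k) w = a w *~ k.
  by case: k => n; rewrite ?NegzE ?mulrNz -?pmulrn ?ffunE ffunMnE.
rewrite (bigD1 I) //= mulzE descent_sumE -defI eqxx.
rewrite big1 ?addr0 ?intz // => J /andP[_ nJ].
by rewrite mulzE descent_sumE -defI eq_sym (negPf nJ) mul0rz.
Qed.

(* Main.v *)
(* Let c = ts and let q_k be the alternating word of length k ending in s, so
   that k |-> q_k identifies Z/4m with W and the length of q_k is the distance
   from k to 0 on the cycle Z/4m.  Right multiplication by s, t, sts sends k to
   1 - k, -1 - k, 3 - k, so each of these reflections is a descent of q_k exactly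
   when k lies in an interval of length 2m: [1, 2m], [2m, 4m - 1], [2, 2m + 1].
   Hence the descent classes are intervals, and with z = c^m (the longest
   element) and e = q_0 + ... + q_(2m-1) = (1 + s)(1 + c + ... + c^(m-1)) the
   module D_A(W) is spanned by {1, s, e} and z {1, s, e} when A = {s, t, sts},
   by {1 + s, e} and z {1 + s, e} when A = {t, sts}.  It is closed under products
   because z is a central involution and
     s e = e,   e s = z e + (1 + s)(1 - z),   e e = m (1 + z) e + e - z e. *)
Require Import Defs.
From mathcomp Require Import all_boot all_order all_algebra all_fingroup.
From mathcomp Require Import zify.

Set Implicit Arguments.
Unset Strict Implicit.
Unset Printing Implicit Defensive.

Import GRing.Theory.
Local Open Scope group_scope.

(** * Alternating words and the cycle Z/4m *)

Section AlternatingWords.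
Variables (W : finGroupType) (s t : W).

(** The letter that extends q_k on the left to q_(k+1); the other letter leads back to q_(k-1). *)
Definition alt_letter (k : nat) : W := if odd k then t else s.

Definition alt_word (k : nat) : W := s ^+ odd k * (t * s) ^+ k./2.

Lemma alt_wordSS (k : nat) : alt_word k.+2 = alt_word k * (t * s).
Proof. by rewrite /alt_word /= negbK expgSr mulgA. Qed.

Hypotheses (ss : s * s = 1) (tt : t * t = 1).

Lemma alt_wordS (k : nat) : alt_word k.+1 = alt_letter k * alt_word k.
Proof.
elim/ltn_ind: k => -[|[|k]] IHk.
- by rewrite /alt_word /alt_letter /= expg0 expg1 mul1g.
- by rewrite /alt_word /alt_letter /= expg0 !expg1 mul1g mulg1.
- by rewrite !alt_wordSS IHk // /alt_letter [odd k.+2]/= negbK -mulgA.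
Qed.

Lemma alt_letterK (k : nat) : alt_letter k * alt_word k.+1 = alt_word k.
Proof.
by rewrite alt_wordS mulgA /alt_letter; case: odd; rewrite ?ss ?tt mul1g.
Qed.

Lemma alt_letter_in (k : nat) : alt_letter k \in [set s; t].
Proof. by rewrite /alt_letter !inE; case: odd; rewrite eqxx ?orbT. Qed.

Variable m : nat.
Hypotheses (m_gt0 : (0 < m)%N) (ord_st : #[s * t] = (2 * m)%N).
Hypothesis genW : <<[set s; t]>> = [set: W].

Lemma expg_rotation : (t * s) ^+ (2 * m) = 1.
Proof.
have -> : t * s = (s * t)^-1.
  by apply/eqP; rewrite eq_sym eq_invg_mul mulgA -[s * t * t]mulgA tt mulg1 ss.
by rewrite expgVn -ord_st expg_order invg1.
Qed.

Lemma alt_word_shift (k j : nat) :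
  alt_word (k + 2 * j) = alt_word k * (t * s) ^+ j.
Proof.
elim: j => [|j IHj]; first by rewrite muln0 addn0 mulg1.
by rewrite mulnS addnCA add2n alt_wordSS IHj expgSr -mulgA.
Qed.

Lemma alt_word_period (k : nat) : alt_word (k + 4 * m) = alt_word k.
Proof.
by rewrite -[4%N]/(2 * 2)%N -mulnA alt_word_shift expg_rotation mulg1.
Qed.

(** Since q_(k+2) s = q_k s (ts)^(-1), two steps up in k are two steps down in l. The sum is 4m + 1
    rather than 1 so that l stays a natural number. *)
Lemma alt_word_mulrs (k l : nat) : (k + l)%N = (4 * m).+1 ->
  alt_word k * s = alt_word l.
Proof.
elim/ltn_ind: k l => -[|[|k]] IHk l kl.
- have -> : l = (1 + 4 * m)%N by lia.
  by rewrite alt_word_period /alt_word /= !expg0 expg1 !mul1g mulg1.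
- have -> : l = (0 + 4 * m)%N by lia.
  by rewrite alt_word_period /alt_word /= !expg0 expg1 !mulg1.
- have: alt_word k * s = alt_word l.+2 by apply: IHk; lia.
  rewrite !alt_wordSS => IH; apply: (mulIg (t * s)); rewrite -IH.
  by rewrite -!mulgA (mulgA s s) ss mul1g (mulgA t t) tt mul1g.
Qed.

Lemma alt_word_mulrt (k l : nat) : (k + l)%N = (4 * m).-1 ->
  alt_word k * t = alt_word l.
Proof.
move=> kl; rewrite -(@alt_word_mulrs k.+2 l); last by lia.
by rewrite alt_wordSS -!mulgA ss mulg1.
Qed.

Lemma alt_word_mulrsts (k l : nat) : (k + l)%N = (4 * m + 3)%N ->
  alt_word k * (s * t * s) = alt_word l.
Proof.
have c_sts : t * s * (s * t * s) = s.
  by rewrite -!mulgA (mulgA s s) ss mul1g (mulgA t t) tt mul1g.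
(* For l >= 2, q_l = q_(l-2) ts and q_(l-2) = q_k s. For l = 0 and l = 1 the index k exceeds 4m, so
   a period is removed and [c_sts] is applied to q_3 and q_2. *)
case: l => [|[|l]] kl.
- rewrite -(alt_word_period 0) -[k](subnK (_ : 4 * m <= k)%N); last by lia.
  rewrite alt_word_period; have -> : (k - 4 * m)%N = 3%N by lia.
  rewrite -(@alt_word_mulrs 1 (0 + 4 * m)) //.
  by rewrite alt_wordSS -mulgA c_sts.
- rewrite -(alt_word_period 1) -[k](subnK (_ : 4 * m <= k)%N); last by lia.
  rewrite alt_word_period; have -> : (k - 4 * m)%N = 2%N by lia.
  rewrite -(@alt_word_mulrs 0 (1 + 4 * m)) //.
  by rewrite alt_wordSS -mulgA c_sts.
- rewrite alt_wordSS -(@alt_word_mulrs k l); last by lia.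
  by rewrite !mulgA.
Qed.

(** Left multiplication by a generator moves q_k to a neighbour on the cycle, so n factors reach
    only indices at distance at most n from 0. This yields both the surjectivity of [alt_word] and
    the lower bound for lengths. *)
Lemma mem_expgs_alt_word (n : nat) (w : W) : w \in [set s; t] ^+ n ->
  exists k, [/\ (k < 4 * m)%N, w = alt_word k
    & (k <= n)%N || (4 * m <= k + n)%N].
Proof.
elim: n w => [|n IHn] w.
  rewrite expg0 inE => /eqP->; exists 0%N.
  by split; rewrite /alt_word ?expg0 ?mulg1 //; lia.
rewrite expgS => /mulsgP[y v yS /IHn[k [ltk -> kn]] ->].
(* One generator leads up from q_k, the other down; adding 4m gives k = 0 a predecessor. *)
have [->|->] : y = alt_letter k \/ y = alt_letter (k + 4 * m).-1.
  have -> : alt_letter (k + 4 * m).-1 = if odd k then s else t.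
    rewrite /alt_letter; have -> : odd (k + 4 * m).-1 = ~~ odd k by lia.
    by case: odd.
  by move: yS; rewrite /alt_letter !inE => /orP[] /eqP->; case: odd; auto.
- rewrite -alt_wordS; case: (ltnP k.+1 (4 * m)) => hk.
    by exists k.+1; split=> //; lia.
  exists 0%N; split; [lia| |lia].
  by rewrite -(alt_word_period 0); congr alt_word; lia.
- rewrite -(alt_word_period k).
  rewrite -[in alt_word (k + _)](prednK (_ : 0 < k + 4 * m)%N); last by lia.
  rewrite alt_letterK; case: (posnP k) => [->|k0].
    by exists (4 * m).-1; split=> //; lia.
  exists k.-1; split; [lia| |lia].
  by rewrite -(alt_word_period k.-1); congr alt_word; lia.
Qed.

Lemma alt_word_surj (w : W) : exists2 k, (k < 4 * m)%N & w = alt_word k.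
Proof.
have /Defs.gen_expgs[n _ /mem_expgs_alt_word[k [ltk -> _]]] : w \in <<[set s; t]>>.
  by rewrite genW inE.
by exists k.
Qed.

(** * Lengths and descents of the alternating words *)

Hypothesis cardW : #|W| = (4 * m)%N.

(** A surjection between finite sets of the same cardinality 4m is injective. *)
Lemma alt_word_inj : {in gtn (4 * m)%N &, injective alt_word}.
Proof.
pose f (i : 'I_(4 * m)) := alt_word i.
have f_inj : injective f.
  suff /image_injP f_inj : #|image f 'I_(4 * m)| == #|'I_(4 * m)|.
    by move=> i j; apply: f_inj.
  rewrite [X in _ == X]card_ord -[X in _ == X]cardW; apply/eqP/eq_card => w.
  have [k ltk ->] := alt_word_surj w.
  by rewrite [RHS]inE; apply/imageP; exists (Ordinal ltk).
move=> k l ltk ltl /(@f_inj (Ordinal ltk) (Ordinal ltl)).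
by case.
Qed.

Lemma alt_word_expgs (k : nat) : alt_word k \in [set s; t] ^+ k.
Proof.
elim: k => [|k IHk]; first by rewrite /alt_word !expg0 mulg1 inE.
by rewrite alt_wordS expgS mem_mulg ?alt_letter_in.
Qed.

(** The other way round the cycle, descending from q_(4m) = 1. *)
Lemma alt_word_expgs_co (k : nat) : (k <= 4 * m)%N ->
  alt_word (4 * m - k) \in [set s; t] ^+ k.
Proof.
elim: k => [|k IHk] lek.
  by rewrite subn0 -[(4 * m)%N]add0n alt_word_period /alt_word !expg0 mulg1 inE.
rewrite -alt_letterK expgS mem_mulg ?alt_letter_in //.
by rewrite -subSn // subSS IHk // ltnW.
Qed.

(** The two arcs from 0 to k give words of lengths k and 4m - k. Conversely a shortest word bounds
    the distance from 0 of some index l with q_l = q_k, and l = k by injectivity. *)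
Lemma cox_length_alt_word (k : nat) : (k < 4 * m)%N ->
  cox_length [set s; t] (alt_word k) = minn k (4 * m - k).
Proof.
move=> ltk.
have [] : _ /\ _ := cox_length_min (_ : alt_word k \in <<[set s; t]>>).
  by rewrite genW inE.
move=> /mem_expgs_alt_word[l [ltl /alt_word_inj eq_kl hl]] len_min.
have eqkl := eq_kl ltk ltl.
have h1 := len_min _ (alt_word_expgs k).
have : alt_word k \in [set s; t] ^+ (4 * m - k).
  by rewrite -{1}(subKn (ltnW ltk)) alt_word_expgs_co // leq_subr.
by move/len_min; lia.
Qed.

(** Serves the reflected indices 4m + 1 - k and 4m + 3 - k, which pass 4m when k is small. *)
Lemma cox_length_alt_word_period (k : nat) : (4 * m <= k < 8 * m)%N ->
  cox_length [set s; t] (alt_word k) = minn (k - 4 * m) (8 * m - k).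
Proof.
move=> hk; rewrite -[k](subnK (_ : 4 * m <= k)%N); last by lia.
rewrite alt_word_period cox_length_alt_word; lia.
Qed.

Lemma descent_s (k : nat) : (k < 4 * m)%N ->
  (cox_length [set s; t] (alt_word k * s)
     < cox_length [set s; t] (alt_word k))%N
    = (1 <= k <= 2 * m)%N.
Proof.
move=> ltk; rewrite (@alt_word_mulrs k ((4 * m).+1 - k)); last by lia.
rewrite (cox_length_alt_word ltk).
(* The reflected index 4m + 1 - k lies in the second period exactly when k < 2. *)
case: (ltnP k 2) => h.
  by rewrite cox_length_alt_word_period; lia.
by rewrite cox_length_alt_word; lia.
Qed.

Lemma descent_t (k : nat) : (k < 4 * m)%N ->
  (cox_length [set s; t] (alt_word k * t)
     < cox_length [set s; t] (alt_word k))%N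
    = (2 * m <= k)%N.
Proof.
move=> ltk; rewrite (@alt_word_mulrt k ((4 * m).-1 - k)); last by lia.
by rewrite !cox_length_alt_word; lia.
Qed.

Lemma descent_sts (k : nat) : (k < 4 * m)%N ->
  (cox_length [set s; t] (alt_word k * (s * t * s))
     < cox_length [set s; t] (alt_word k))%N = (2 <= k <= (2 * m).+1)%N.
Proof.
move=> ltk; rewrite (@alt_word_mulrsts k (4 * m + 3 - k)); last by lia.
rewrite (cox_length_alt_word ltk).
case: (ltnP k 4) => h.
  by rewrite cox_length_alt_word_period; lia.
by rewrite cox_length_alt_word; lia.
Qed.

End AlternatingWords.

Local Open Scope ring_scope.

(** * Identities in a ring with dihedral relations *)

Section DihedralRing.
Variables (R : nzRingType) (S C : R) (m : nat).
Hypotheses (SS : S * S = 1) (CSC : C * S * C = S) (C_ord : C ^+ (2 * m) = 1).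

Let z := C ^+ m.
Let g := \sum_(j < m) C ^+ j.
Let e := (1 + S) * g.

Lemma dihedral_center_sq : z * z = 1.
Proof. by rewrite -exprD addnn -mul2n. Qed.

Lemma dihedral_expS (j : nat) : C ^+ j * S * C ^+ j = S.
Proof.
elim: j => [|j IHj]; first by rewrite expr0 mul1r mulr1.
by rewrite {1}exprSr exprS !mulrA -(mulrA _ C S) -(mulrA _ (C * S)) CSC.
Qed.

(** S conjugates C to its inverse; C^(2m-j) stands for the inverse of C^j. *)
Lemma dihedral_mulS (j : nat) : (j <= 2 * m)%N ->
  C ^+ j * S = S * C ^+ (2 * m - j).
Proof.
move=> le_j; rewrite -[LHS]mulr1 -C_ord -{1}(subnKC le_j) exprD mulrA.
by rewrite dihedral_expS.
Qed.

Lemma dihedral_center_mulS : z * S = S * z.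
Proof. by rewrite dihedral_mulS ?leq_pmull // mul2n -addnn addnK. Qed.

Lemma dihedral_center_mulDS : z * (1 + S) = (1 + S) * z.
Proof. by rewrite mulrDr mulrDl mulr1 mul1r dihedral_center_mulS. Qed.

Lemma dihedral_mulSe : S * e = e.
Proof. by rewrite /e mulrA mulrDr mulr1 SS addrC. Qed.

(** Moving S to the left turns the exponents 0, ..., m-1 into 2m, ..., m+1. Those of z g are m, ...,
    2m-1, so C^m = z has to be exchanged for C^(2m) = 1. *)
Lemma dihedral_sumS : g * S = S * (z * g + 1 - z).
Proof.
rewrite mulr_suml; under eq_bigr => j _.
  rewrite dihedral_mulS; last first.
    by rewrite (leq_trans (ltnW (ltn_ord j))) ?leq_pmull.
  over.
rewrite -mulr_sumr; congr (_ * _); apply/eqP; rewrite eq_sym subr_eq; apply/eqP.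
have -> : \sum_(j < m) C ^+ (2 * m - j) + z = \sum_(j < m.+1) C ^+ (2 * m - j).
  by rewrite big_ord_recr /= mul2n -addnn addnK.
rewrite big_ord_recl subn0 C_ord addrC; congr (_ + _).
rewrite mulr_sumr (reindex_inj rev_ord_inj) /=; apply: eq_bigr => j _.
by rewrite -exprD; congr (_ ^+ _); have := ltn_ord j; rewrite /bump; lia.
Qed.

Lemma dihedral_mul_eS : e * S = z * e + (1 + S) * (1 - z).
Proof.
rewrite /e -mulrA dihedral_sumS mulrA (mulrDl 1 S S) mul1r SS (addrC S).
by rewrite -addrA mulrDr !mulrA dihedral_center_mulDS.
Qed.

(** The product (1 + z) g is the sum of all powers of C. It absorbs C because (C - 1) g = z - 1
    telescopes and (1 + z) (z - 1) = 0. *)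
Lemma dihedral_full_sumC : (1 + z) * g * C = (1 + z) * g.
Proof.
have gC : g * C = C * g.
  by apply/esym/commr_sum => j _; apply/commrX.
apply/eqP; rewrite -subr_eq0 -mulrA -mulrBr gC -{2}[g]mul1r -mulrBl.
rewrite -subrX1 -/z mulrBr mulr1 mulrDl mul1r dihedral_center_sq.
by rewrite (addrC z) subrr.
Qed.

(** As (1 + z) e = (1 + S) (1 + z) g absorbs C, each of the m powers in the right factor g
    contributes one copy. *)
Lemma dihedral_full_sum : (1 + z) * e * g = (1 + z) * e *+ m.
Proof.
have eE : (1 + z) * e = (1 + S) * ((1 + z) * g).
  rewrite /e !mulrA; congr (_ * _).
  by rewrite !(mulrDl, mulrDr) !(mul1r, mulr1) dihedral_center_mulS addrACA.
rewrite eE mulr_sumr -[in RHS](card_ord m) -sumr_const.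
apply: eq_bigr => j _; rewrite -mulrA; congr (_ * _).
elim: (val j) => [|i IHi]; first by rewrite mulr1.
by rewrite exprSr mulrA IHi dihedral_full_sumC.
Qed.

(** Expand e (1 + S) first: its part (1 + z) e is then multiplied by g as above, and its part (1 +
    S) (1 - z) becomes (1 - z) e after z is moved to the left. *)
Lemma dihedral_mul_ee : e * e = (1 + z) * e *+ m + (e - z * e).
Proof.
have eDS : e * (1 + S) = (1 + z) * e + (1 + S) * (1 - z).
  by rewrite mulrDr mulr1 dihedral_mul_eS addrA [(1 + z) * e]mulrDl mul1r.
rewrite {2}/e mulrA eDS mulrDl dihedral_full_sum; congr (_ + _).
have -> : (1 + S) * (1 - z) = (1 - z) * (1 + S).
  by rewrite mulrBr mulrBl mul1r mulr1 dihedral_center_mulDS.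
by rewrite -mulrA mulrBl mul1r.
Qed.

End DihedralRing.

(** * Integer submodules and closure under products *)

Section IntSubmodule.
Variable R : nzRingType.

(** Spanning is phrased below as an induction principle: any such submodule containing the
    generators contains the whole module. *)
Definition int_submodule (P : R -> Prop) : Prop :=
  [/\ P 0, forall x y, P x -> P y -> P (x + y)
    & forall (k : int) x, P x -> P (x *~ k)].

Section Closure.
Variable P : R -> Prop.
Hypothesis subP : int_submodule P.

Lemma int_submodule0 : P 0. Proof. by case: subP. Qed.

Lemma int_submoduleD x y : P x -> P y -> P (x + y).
Proof. by case: subP => _ + _; apply. Qed.

Lemma int_submoduleMz k x : P x -> P (x *~ k).
Proof. by case: subP => _ _; apply. Qed.

Lemma int_submoduleMn n x : P x -> P (x *+ n).
Proof. by rewrite pmulrn; apply: int_submoduleMz. Qed.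

Lemma int_submoduleB x y : P x -> P y -> P (x - y).
Proof.
by move=> Px Py; rewrite -[y]mulr1z -mulrNz; apply/int_submoduleD/int_submoduleMz.
Qed.

Lemma int_submodule_lmul a : int_submodule (fun y => P (a * y)).
Proof.
split=> [|x y Px Py|k x Px]; first by rewrite mulr0; apply: int_submodule0.
- by rewrite mulrDr; apply: int_submoduleD.
- by rewrite mulrzAr; apply: int_submoduleMz.
Qed.

(** The left multipliers of P form a submodule, so closure under products need only be tested on
    generators as left factors. *)
Lemma int_submodule_rmul : int_submodule (fun x => forall y, P y -> P (x * y)).
Proof.
split=> [y _|x x' Px Px' y Py|k x Px y Py].
- by rewrite mul0r; apply: int_submodule0.
- by rewrite mulrDl; apply: int_submoduleD; [apply: Px | apply: Px'].
- by rewrite mulrzAl; apply/int_submoduleMz/Px.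
Qed.

(* The module spanned by [B] and [z * B]; only products of two elements of [B]
   have to be checked, as [z] is an involution commuting with them. *)
Lemma subalgebra_of_gens (z : R) (B : seq R) :
    z * z = 1 -> {in B, forall b, z * b = b * z} ->
    (forall Q, int_submodule Q -> {in B, forall b, Q b /\ Q (z * b)} ->
       forall x, P x -> Q x) ->
    {in B, forall b, P b /\ P (z * b)} ->
    {in B &, forall b b', P (b * b')} ->
  subalgebra P.
Proof.
move=> zz zB spanP PB PBB.
have Pz : forall y, P y -> P (z * y).
  apply: spanP; first exact: int_submodule_lmul.
  by move=> b /PB[Pb Pzb]; rewrite mulrA zz mul1r.
have PlB : {in B, forall b y, P y -> P (b * y)}.
  move=> b Bb; apply: spanP; first exact: int_submodule_lmul.
  move=> b' Bb'; have Pbb' := PBB _ _ Bb Bb'.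
  by rewrite mulrA -zB // -mulrA; split=> //; apply: Pz.
split; [exact: int_submodule0|exact: int_submoduleD|exact: int_submoduleMz|].
move=> x y Px; move: x Px y; apply: spanP; first exact: int_submodule_rmul.
move=> b Bb; split=> y Py; first exact: PlB.
by rewrite -mulrA; apply/Pz/PlB.
Qed.

End Closure.
End IntSubmodule.

(** * The descent module as functions of the descent set *)

Section DescentModule.
Variables (W : finGroupType) (S A : {set W}).

Lemma ZGroupRing_mulz (a : ZGroupRing W) (k : int) w : (a *~ k) w = a w *~ k.
Proof. by case: k => n; rewrite ?NegzE ?mulrNz -?pmulrn ?ffunE ffunMnE. Qed.

(** Each w lies in exactly one descent class, so only the term of that class contributes to the
    coefficient at w. *)
Lemma descent_moduleP (x : ZGroupRing W) :
  descent_module S A x <->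
  exists f : {set W} -> int, forall w, x w = f (descents S A w).
Proof.
have sumE (f : {set W} -> int) w :
    (\sum_(I in admissible S A) descent_sum S A I *~ f I) w
      = f (descents S A w).
  have adw : descents S A w \in admissible S A by apply: imset_f.
  rewrite sum_ffunE (bigD1 _ adw) /= ZGroupRing_mulz descent_sumE eqxx intz.
  rewrite big1 ?addr0 // => I /andP[_ nI].
  by rewrite ZGroupRing_mulz descent_sumE eq_sym (negPf nI) mul0rz.
split=> [[f ->]|[f xE]]; exists f; first exact: sumE.
by apply/ffunP => w; rewrite sumE.
Qed.

Lemma descent_module_int_submodule : int_submodule (descent_module S A).
Proof.
split=> [|x y|k x]; rewrite !descent_moduleP.
- by exists (fun=> 0) => w; rewrite ffunE.
- move=> [f fE] [h hE]; exists (fun I => f I + h I) => w.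
  by rewrite ffunE fE hE.
- move=> [f fE]; exists (fun I => f I *~ k) => w.
  by rewrite ZGroupRing_mulz fE.
Qed.

End DescentModule.

(** * Sums over index intervals in the group ring *)

Section AlternatingSums.
Variables (m : nat) (W : finGroupType) (s t : W).
Hypotheses (m_gt0 : (0 < m)%N) (ss : (s * s)%g = 1%g) (tt : (t * t)%g = 1%g).
Hypotheses (ord_st : #[(s * t)%g]%g = (2 * m)%N).
Hypotheses (genW : <<[set s; t]>>%g = [set: W]) (cardW : #|W| = (4 * m)%N).

Local Notation q := (alt_word s t).
Let surj := alt_word_surj ss tt m_gt0 ord_st genW.
Let inj := alt_word_inj ss tt m_gt0 ord_st genW cardW.

Definition alt_sum (a b : nat) : ZGroupRing W :=
  \sum_(a <= i < b) gr_elt (q i).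

Lemma gr_eltX (g : W) n : gr_elt (g ^+ n)%g = gr_elt g ^+ n.
Proof.
by elim: n => [|n IHn]; rewrite ?expg0 // expgS exprS -gr_eltM IHn.
Qed.

Lemma gr_elt_alt_word k :
  gr_elt (q k) = gr_elt s ^+ odd k * gr_elt (t * s)%g ^+ k./2.
Proof. by rewrite -!gr_eltX gr_eltM. Qed.

Lemma alt_sumE a b k : (b <= 4 * m)%N -> (k < 4 * m)%N ->
  alt_sum a b (q k) = (a <= k < b)%N%:R.
Proof.
move=> leb ltk; rewrite sum_ffunE.
have -> : \sum_(a <= i < b) gr_elt (q i) (q k) = \sum_(a <= i < b | i == k) 1.
  rewrite [RHS]big_mkcond; apply: eq_big_nat => i /andP[_ ltib].
  rewrite ffunE (inj_in_eq inj) ?inE //; last exact: leq_trans ltib leb.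
  by rewrite eq_sym; case: eqP.
by rewrite big_nat1_eq; case: ifP.
Qed.

Lemma alt_sum_cat a b c : (a <= b)%N -> (b <= c)%N ->
  alt_sum a c = alt_sum a b + alt_sum b c.
Proof. exact: big_cat_nat. Qed.

Lemma alt_sum1 a : alt_sum a a.+1 = gr_elt (q a).
Proof. exact: big_nat1. Qed.

(** The words are taken in pairs: q_(2j) + q_(2j+1) = (1 + s) (ts)^j. *)
Lemma alt_sum_double n :
  alt_sum 0 n.*2 = (1 + gr_elt s) * \sum_(j < n) gr_elt (t * s)%g ^+ j.
Proof.
elim: n => [|n IHn]; first by rewrite /alt_sum big_nil big_ord0 mulr0.
rewrite doubleS (@alt_sum_cat 0 n.*2) ?leqW // IHn big_ord_recr mulrDr.
congr (_ + _); rewrite (@alt_sum_cat _ n.*2.+1) // !alt_sum1.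
rewrite !gr_elt_alt_word /= odd_double uphalf_double doubleK /=.
by rewrite mul1r mulrDl mul1r.
Qed.

Let S := gr_elt s.
Let C := gr_elt (t * s)%g.
Let z := C ^+ m.
Let e := alt_sum 0 (2 * m).

Lemma half_sumE : e = (1 + S) * \sum_(j < m) C ^+ j.
Proof. by rewrite /e mul2n alt_sum_double. Qed.

Let SS : S * S = 1.
Proof. by rewrite gr_eltM ss. Qed.

Let CSC : C * S * C = S.
Proof.
rewrite !gr_eltM; congr gr_elt.
by rewrite -!mulgA (mulgA s s) ss mul1g (mulgA t t) tt mul1g.
Qed.

Let C_ord : C ^+ (2 * m) = 1.
Proof. by rewrite -gr_eltX expg_rotation. Qed.

Let zz : z * z = 1 := dihedral_center_sq C_ord.

Lemma alt_sum_mulz a b : alt_sum a b * z = alt_sum (a + 2 * m) (b + 2 * m).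
Proof.
rewrite /alt_sum big_addn addnK mulr_suml; apply: eq_bigr => i _.
by rewrite /z -gr_eltX gr_eltM alt_word_shift.
Qed.

Lemma alt_sum_commz a b : z * alt_sum a b = alt_sum a b * z.
Proof.
apply: commr_sum => i _; rewrite gr_elt_alt_word; apply: commrM.
  by apply: commrX; apply: (dihedral_center_mulS CSC C_ord).
by apply/commrX/commr_sym/commrX.
Qed.

Lemma alt_sum_zmul a b : z * alt_sum a b = alt_sum (a + 2 * m) (b + 2 * m).
Proof. by rewrite alt_sum_commz alt_sum_mulz. Qed.

(** Writes x along the cycle, so that it can be cut into intervals with constant coefficients. *)
Lemma ZGroupRing_alt_expansion (x : ZGroupRing W) :
  x = \sum_(0 <= i < 4 * m) gr_elt (q i) *~ x (q i).
Proof.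
apply/ffunP => w; have [k ltk ->] := surj w.
rewrite sum_ffunE (big_cat_nat (n := k)) ?(ltnW ltk) //=.
rewrite [X in _ + X]big_ltn // ZGroupRing_mulz ffunE eqxx intz.
rewrite !big1_seq ?add0r ?addr0 // => i /andP[_]; rewrite mem_index_iota => hi.
all: rewrite ZGroupRing_mulz ffunE (inj_in_eq inj) ?inE //; try lia.
all: by case: eqP => [ki|_]; rewrite ?mul0rz //; lia.
Qed.

Lemma int_submodule_cut (Q : ZGroupRing W -> Prop)
    (F : nat -> ZGroupRing W) a b c :
    int_submodule Q -> (a <= b <= c)%N ->
    Q (\sum_(a <= i < b) F i) -> Q (\sum_(b <= i < c) F i) ->
  Q (\sum_(a <= i < c) F i).
Proof.
move=> subQ /andP[leab lebc] Qab Qbc.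
by rewrite (big_cat_nat leab lebc); apply: int_submoduleD.
Qed.

(** * Intervals cut out by descent sets *)

Section Module.
Variable A : {set W}.
Let P := descent_module [set s; t] A.
Let D := descents [set s; t] A.

Let subP : int_submodule P.
Proof. exact: descent_module_int_submodule. Qed.

Lemma descent_module_alt_sum (f : {set W} -> bool) a b : (b <= 4 * m)%N ->
  (forall k, (k < 4 * m)%N -> (a <= k < b)%N = f (D (q k))) -> P (alt_sum a b).
Proof.
move=> leb fE; apply/descent_moduleP; exists (fun I => (f I)%:R) => w.
by have [k ltk ->] := surj w; rewrite alt_sumE // fE.
Qed.

(** Where the descent set does not change, the coefficients of x are constant, and the piece is an
    integer multiple of [alt_sum a b]. *)
Lemma descent_module_piece (Q : ZGroupRing W -> Prop) (x : ZGroupRing W) a b :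
    int_submodule Q -> P x -> Q (alt_sum a b) ->
    (forall k, (a <= k < b)%N -> D (q k) = D (q a)) ->
  Q (\sum_(a <= i < b) gr_elt (q i) *~ x (q i)).
Proof.
move=> subQ /descent_moduleP[f fE] Qab Dab.
have -> : \sum_(a <= i < b) gr_elt (q i) *~ x (q i)
    = alt_sum a b *~ f (D (q a)).
  by rewrite mulrz_suml; apply: eq_big_nat => i /Dab; rewrite fE /D => ->.
exact: int_submoduleMz.
Qed.

Lemma mem_descents_s k : s \in A -> (k < 4 * m)%N ->
  (s \in D (q k)) = (1 <= k <= 2 * m)%N.
Proof.
by move=> Ar ltk; rewrite inE Ar (descent_s ss tt m_gt0 ord_st genW cardW).
Qed.

Lemma mem_descents_t k : t \in A -> (k < 4 * m)%N ->
  (t \in D (q k)) = (2 * m <= k)%N.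
Proof.
by move=> Ar ltk; rewrite inE Ar (descent_t ss tt m_gt0 ord_st genW cardW).
Qed.

Lemma mem_descents_sts k : (s * t * s)%g \in A -> (k < 4 * m)%N ->
  ((s * t * s)%g \in D (q k)) = (2 <= k <= (2 * m).+1)%N.
Proof.
by move=> Ar ltk; rewrite inE Ar (descent_sts ss tt m_gt0 ord_st genW cardW).
Qed.

Lemma descents_eq u v :
  {in A, forall r, (r \in D u) = (r \in D v)} -> D u = D v.
Proof.
move=> Duv; apply/setP => r.
by have [/Duv //|nAr] := boolP (r \in A); rewrite !inE (negPf nAr).
Qed.

End Module.

Lemma mul_s_half : S * e = e.
Proof. by rewrite half_sumE; exact: dihedral_mulSe. Qed.

Lemma mul_half_s : e * S = z * e + (1 + S) * (1 - z).
Proof. by rewrite half_sumE; exact: dihedral_mul_eS. Qed.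

Lemma mul_half_half : e * e = (1 + z) * e *+ m + (e - z * e).
Proof. by rewrite half_sumE; exact: dihedral_mul_ee. Qed.

Lemma alt_sum01 : alt_sum 0 1 = 1.
Proof. by rewrite alt_sum1 gr_elt_alt_word mulr1. Qed.

Lemma alt_sum12 : alt_sum 1 2 = S.
Proof. by rewrite alt_sum1 gr_elt_alt_word mulr1. Qed.

Lemma alt_sum02 : alt_sum 0 2 = 1 + S.
Proof. by rewrite (@alt_sum_cat 0 1 2) // alt_sum01 alt_sum12. Qed.

Lemma int_submodule_half_half P :
  int_submodule P -> P e -> P (z * e) -> P (e * e).
Proof.
move=> subP Pe Pze; rewrite mul_half_half; apply: int_submoduleD => //.
  by apply: int_submoduleMn => //; rewrite mulrDl mul1r; apply: int_submoduleD.
exact: int_submoduleB.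
Qed.

Lemma alt_sum_tail a : (a <= 2 * m)%N ->
  alt_sum a (2 * m) = e - alt_sum 0 a.
Proof. by move=> lea; rewrite /e (@alt_sum_cat 0 a) // addrC addKr. Qed.

(** The rest of the half cycle is e minus its initial piece; multiplication by z shifts indices by
    2m and gives the second half. *)
Lemma int_submodule_tail (Q : ZGroupRing W -> Prop) a :
    (a <= 2 * m)%N -> int_submodule Q -> Q e -> Q (z * e) ->
    Q (alt_sum 0 a) -> Q (z * alt_sum 0 a) ->
  Q (alt_sum a (2 * m)) /\ Q (alt_sum (a + 2 * m) (4 * m)).
Proof.
move=> lea subQ Qe Qze Qa Qza.
have -> : (4 * m = 2 * m + 2 * m)%N by lia.
rewrite -alt_sum_zmul alt_sum_tail // mulrBr.
by split; apply: int_submoduleB.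
Qed.

(** * Closure under products for the two choices of A *)

Lemma subalgebra_s_t_sts :
  subalgebra (descent_module [set s; t] [set s; t; (s * t * s)%g]).
Proof.
set A := [set s; t; _]; set P := descent_module _ A.
have subP : int_submodule P by apply: descent_module_int_submodule.
have [As At Au] : [/\ s \in A, t \in A & (s * t * s)%g \in A].
  by rewrite !inE !eqxx ?orbT.
have Dt := mem_descents_t At; have Ds := mem_descents_s As.
have Du := mem_descents_sts Au.
have D_eq k l : (k < 4 * m)%N -> (l < 4 * m)%N ->
    (1 <= k <= 2 * m)%N = (1 <= l <= 2 * m)%N ->
    (2 * m <= k)%N = (2 * m <= l)%N ->
    (2 <= k <= (2 * m).+1)%N = (2 <= l <= (2 * m).+1)%N ->
    descents [set s; t] A (q k) = descents [set s; t] A (q l).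
  move=> ltk ltl; rewrite -!Ds // -!Dt // -!Du // => es et eu.
  apply: descents_eq => r.
  by rewrite {1}/A 2!in_setU !in_set1 => /orP[/orP[]|] /eqP->.
pose B := [:: 1; S; e].
(* The six generators are the sums over [0, 1), [1, 2), [0, 2m) and their shifts by 2m; each [f] is
   a test on the descent set that singles out one of these intervals. *)
have BP : {in B, forall b, P b /\ P (z * b)}.
  move=> b; rewrite !inE -alt_sum01 -alt_sum12.
  case/or3P=> /eqP->; rewrite alt_sum_zmul; split.
  - apply: (descent_module_alt_sum
      (f := fun I => (s \notin I) && (t \notin I))) => [|k ltk]; first lia.
    by rewrite Ds // Dt //; lia.
  - apply: (descent_module_alt_sum
      (f := fun I => (s \in I) && (t \in I))) => [|k ltk]; first lia.
    by rewrite Ds // Dt //; lia.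
  - apply: (descent_module_alt_sum
      (f := fun I => (s \in I) && ((s * t * s)%g \notin I))) => [|k ltk].
      lia.
    by rewrite Ds // Du //; lia.
  - apply: (descent_module_alt_sum
      (f := fun I => (s \notin I) && ((s * t * s)%g \in I))) => [|k ltk].
      lia.
    by rewrite Ds // Du //; lia.
  - apply: (descent_module_alt_sum (f := fun I => t \notin I)) => [|k ltk].
      lia.
    by rewrite Dt //; lia.
  - apply: (descent_module_alt_sum (f := fun I => t \in I)) => [|k ltk].
      lia.
    by rewrite Dt //; lia.
have [P1 Pz] : P 1 /\ P z by rewrite -[z]mulr1; apply: BP; rewrite !inE eqxx.
have [PS PzS] : P S /\ P (z * S) by apply: BP; rewrite !inE eqxx orbT.
have [Pe Pze] : P e /\ P (z * e) by apply: BP; rewrite !inE eqxx !orbT.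
apply: (subalgebra_of_gens subP zz _ _ BP).
- move=> b; rewrite !inE -alt_sum01 -alt_sum12.
  by case/or3P=> /eqP->; apply: alt_sum_commz.
- move=> Q subQ QB x Px; rewrite [x]ZGroupRing_alt_expansion.
  have /QB[Q1 Qz1] : 1 \in B by rewrite !inE eqxx.
  have /QB[QS QzS] : S \in B by rewrite !inE eqxx orbT.
  have /QB[Qe Qze] : e \in B by rewrite !inE eqxx !orbT.
  have [Q2 Qz2] : Q (alt_sum 2 (2 * m)) /\ Q (alt_sum (2 + 2 * m) (4 * m)).
    apply: int_submodule_tail => //; rewrite ?alt_sum02 ?mulrDr ?mulr1; first lia.
    - exact: int_submoduleD.
    - by apply: int_submoduleD; rewrite // -[z]mulr1.
  move: Q1 QS Qz1 QzS; rewrite -{1 2}alt_sum01 -{1 2}alt_sum12 !alt_sum_zmul.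
  move=> Q01 Q12 Qz01 Qz12.
  have cut := int_submodule_cut subQ.
  (* The cuts at 1, 2, 2m, 2m + 1 and 2m + 2 are the indices where the descent set can change; [2,
     2m) is empty when m = 1. *)
  have piece a b := @descent_module_piece A Q x a b subQ Px.
  apply: (cut _ 0 1 _)%N; [lia | | apply: (cut _ 1 2 _)%N; [lia | |
  apply: (cut _ 2 (2 * m) _)%N; [lia | | apply: (cut _ _ (1 + 2 * m) _)%N;
  [lia | | apply: (cut _ _ (2 + 2 * m) _)%N; [lia | |]]]]];
  by apply: piece => // k hk; apply: D_eq; lia.
(* Among the nine products only e s and e e are not generators themselves. *)
- move=> b b'; rewrite !inE.
  move=> /or3P[] /eqP-> /or3P[] /eqP->; rewrite ?mul1r ?mulr1 ?SS ?mul_s_half //.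
  + rewrite mul_half_s mulrDl mul1r mulrBr mulr1 -(dihedral_center_mulS CSC C_ord).
    by do ?[apply: int_submoduleB => // | apply: int_submoduleD => //].
  + exact: int_submodule_half_half.
Qed.

Lemma subalgebra_t_sts :
  subalgebra (descent_module [set s; t] [set t; (s * t * s)%g]).
Proof.
set A := [set t; _]; set P := descent_module _ A.
have subP : int_submodule P by apply: descent_module_int_submodule.
have [At Au] : t \in A /\ (s * t * s)%g \in A by rewrite !inE !eqxx ?orbT.
have Dt := mem_descents_t At; have Du := mem_descents_sts Au.
have D_eq k l : (k < 4 * m)%N -> (l < 4 * m)%N ->
    (2 * m <= k)%N = (2 * m <= l)%N ->
    (2 <= k <= (2 * m).+1)%N = (2 <= l <= (2 * m).+1)%N ->
    descents [set s; t] A (q k) = descents [set s; t] A (q l).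
  move=> ltk ltl; rewrite -!Dt // -!Du // => et eu.
  by apply: descents_eq => r; rewrite {1}/A in_setU !in_set1 => /orP[] /eqP->.
pose a := 1 + S; pose B := [:: a; e].
have az : a * z = z * a by rewrite /a -alt_sum02 alt_sum_commz.
have BP : {in B, forall b, P b /\ P (z * b)}.
  move=> b; rewrite !inE /a -alt_sum02.
  case/orP=> /eqP->; rewrite alt_sum_zmul; split.
  - apply: (descent_module_alt_sum
      (f := fun I => (t \notin I) && ((s * t * s)%g \notin I))) => [|k ltk].
      lia.
    by rewrite Dt // Du //; lia.
  - apply: (descent_module_alt_sum
      (f := fun I => (t \in I) && ((s * t * s)%g \in I))) => [|k ltk].
      lia.
    by rewrite Dt // Du //; lia.
  - apply: (descent_module_alt_sum (f := fun I => t \notin I)) => [|k ltk].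
      lia.
    by rewrite Dt //; lia.
  - apply: (descent_module_alt_sum (f := fun I => t \in I)) => [|k ltk].
      lia.
    by rewrite Dt //; lia.
have [Pa Pza] : P a /\ P (z * a) by apply: BP; rewrite !inE eqxx.
have [Pe Pze] : P e /\ P (z * e) by apply: BP; rewrite !inE eqxx orbT.
apply: (subalgebra_of_gens subP zz _ _ BP).
- move=> b; rewrite !inE /a -alt_sum02.
  by case/orP=> /eqP->; apply: alt_sum_commz.
- move=> Q subQ QB x Px; rewrite [x]ZGroupRing_alt_expansion.
  have /QB[Qa Qza] : a \in B by rewrite !inE eqxx.
  have /QB[Qe Qze] : e \in B by rewrite !inE eqxx orbT.
  move: Qa Qza; rewrite /a -alt_sum02 => Qa Qza.
  have [Q2 Qz2] : Q (alt_sum 2 (2 * m)) /\ Q (alt_sum (2 + 2 * m) (4 * m)).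
    by apply: int_submodule_tail => //; lia.
  rewrite alt_sum_zmul in Qza.
  have cut := int_submodule_cut subQ.
  (* Without [s] in A, the indices 0 and 1 have equal descent sets, and so do 2m and 2m + 1; the
     cuts at 2, 2m and 2m + 2 remain. *)
  have piece c d := @descent_module_piece A Q x c d subQ Px.
  apply: (cut _ 0 2 _)%N; [lia | | apply: (cut _ 2 (2 * m) _)%N; [lia | |
  apply: (cut _ _ (2 + 2 * m) _)%N; [lia | |]]];
  by apply: piece => // k hk; apply: D_eq; lia.
(* Both generators are fixed by s on the left, so a = 1 + s acts on them from the left as 2. *)
- have aE x : S * x = x -> a * x = x *+ 2 by move=> Sx; rewrite mulrDl mul1r Sx.
  move=> b b'; rewrite !inE => /orP[] /eqP-> /orP[] /eqP->.
  + rewrite aE; first exact: int_submoduleMn.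
    by rewrite mulrDr mulr1 SS addrC.
  + by rewrite aE ?mul_s_half //; apply: int_submoduleMn.
  + rewrite mulrDr mulr1 mul_half_s mulrBr mulr1 az.
    by do ?[apply: int_submoduleB => // | apply: int_submoduleD => //].
  + exact: int_submodule_half_half.
Qed.

End AlternatingSums.

Local Close Scope ring_scope.
Local Close Scope group_scope.

Theorem theoremB (m : nat) (W : finGroupType) (s t : W) :
  (1 <= m)%N ->
  coxeter_system [set s; t] ->
  #|W| = (4 * m)%N ->
  #[(s * t)%g]%g = (2 * m)%N ->
  forall A : {set W},
    A = [set s; t; (s * t * s)%g] \/ A = [set t; (s * t * s)%g] ->
    subalgebra (descent_module [set s; t] A).
Proof.
move=> m_gt0 [genW ord2 _] cardW ord_st A.
have sq x : x \in [set s; t] -> (x * x = 1)%g.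
  by move=> /ord2 ox; rewrite -(expg_order x) ox.
have ss : (s * s = 1)%g by apply: sq; rewrite !inE eqxx.
have tt : (t * t = 1)%g by apply: sq; rewrite !inE eqxx orbT.
by case=> ->; [apply: (subalgebra_s_t_sts m_gt0) | apply: (subalgebra_t_sts m_gt0)].
Qed.
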